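(* Let $\beta_c=\log 4$ and let $0<\beta\le\beta_c$. Define $$K_c^{(2)}(\beta)=\frac{1}{4\beta e^{-\beta}}+\frac{1}{2\beta}>0 .$$ Then the following hold. (a) (i) For $0<K\le K_c^{(2)}(\beta)$, $\mathcal{E}_{\beta,K}=\{\rho_\beta\}$. (ii) For $K>K_c^{(2)}(\beta)$, there exist probability measures $\nu^+(\beta,K)$ and $\nu^-(\beta,K)$ in $\mathcal{P}(\Lambda)$ such that $\nu^+(\beta,K)$, $\nu^-(\beta,K)$, $\rho_\beta$ are pairwise distinct and $\mathcal{E}_{\beta,K}=\{\nu^+(\beta,K),\nu^-(\beta,K)\}$. (b) If we write $\nu^+(\beta,K)=\nu^+_{-1}\delta_{-1}+\nu^+_0\delta_0+\nu^+_1\delta_1$, then $\nu^-(\beta,K)=\nu^+_{1}\delta_{-1}+\nu^+_0\delta_0+\nu^+_{-1}\delta_1$. (c) For each choice of sign, $\nu^{\pm}(\beta,K)$ is a continuous function of $K$ for $K>K_c^{(2)}(\beta)$, and $\nu^{\pm}(\beta,K)\to\rho_\beta$ as $K\to (K_c^{(2)}(\beta))^+$. (In this sense $\mathcal{E}_{\beta,K}$ exhibits a continuous bifurcation at $K_c^{(2)}(\beta)$.)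
   Context: Let $\Lambda=\{-1,0,1\}$ and let $\mathcal{P}(\Lambda)$ be the set of probability measures on $\Lambda$; each $\mu\in\mathcal{P}(\Lambda)$ is written $\mu=\mu_{-1}\delta_{-1}+\mu_0\delta_0+\mu_1\delta_1$ and $\mathcal{P}(\Lambda)$ is topologized as a subset of $\mathbb{R}^3$ (probability vectors). Let $\rho=\frac13(\delta_{-1}+\delta_0+\delta_1)$. The relative entropy is $R(\mu|\rho)=\sum_{i=-1}^1\mu_i\log(3\mu_i)$ (with $0\log 0=0$). For $K>0$ define $$f_K(\mu)=\int_\Lambda y^2\mu(dy)-K\Big(\int_\Lambda y\,\mu(dy)\Big)^2=(\mu_1+\mu_{-1})-K(\mu_1-\mu_{-1})^2 .$$ For $\beta>0$, $K>0$, the set of canonical equilibrium macrostates is $$\mathcal{E}_{\beta,K}=\{\nu\in\mathcal{P}(\Lambda):\nu\text{ minimizes }R(\nu|\rho)+\beta f_K(\nu)\text{ over }\mathcal{P}(\Lambda)\}.$$ The measure $\rho_\beta\in\mathcal{P}(\Lambda)$ is $\rho_\beta(dy)=\frac{1}{Z(\beta)}e^{-\beta y^2}\rho(dy)$ with $Z(\beta)=\int_\Lambda e^{-\beta y^2}\rho(dy)$. *)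

(* Defs.v *)
From HB Require Import structures.
From mathcomp Require Import all_boot all_order all_algebra.
From mathcomp Require Import all_classical all_reals all_analysis.

Set Implicit Arguments.
Unset Strict Implicit.
Unset Printing Implicit Defensive.

Import Order.TTheory GRing.Theory Num.Theory.
Import numFieldNormedType.Exports.

Local Open Scope classical_set_scope.
Local Open Scope ring_scope.

(* A measure mu on Lambda = {-1, 0, 1} is encoded as the row vector
   (mu_{-1}, mu_0, mu_1) : 'rV[R]_3, so that its topology is that of R^3;
   the column index i : 'I_3 stands for the point i - 1 of Lambda. *)

Definition site (R : realType) (i : 'I_3) : R := i%:R - 1.

(* a delta_{-1} + b delta_0 + c delta_1 *)
Definition pvec (R : realType) (a b c : R) : 'rV[R]_3 :=
  \row_i [:: a; b; c]`_i.

Definition prob_vec (R : realType) : set 'rV[R]_3 :=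
  [set mu | (forall i, 0 <= mu 0 i) /\ \sum_i mu 0 i = 1].

Definition integ (R : realType) (mu : 'rV[R]_3) (g : R -> R) : R :=
  \sum_i g (site R i) * mu 0 i.

Definition rho (R : realType) : 'rV[R]_3 := pvec 3^-1 3^-1 3^-1.

(* Relative entropy R(mu|rho) with respect to the uniform measure rho; the
   factor mu_i makes a term with mu_i = 0 vanish, i.e. 0 log 0 = 0. *)
Definition relent_rho (R : realType) (mu : 'rV[R]_3) : R :=
  \sum_i mu 0 i * ln (3 * mu 0 i).

Definition f_ (R : realType) (K : R) (mu : 'rV[R]_3) : R :=
  integ mu (fun y => y ^+ 2) - K * integ mu id ^+ 2.

Definition canonical_functional (R : realType) (beta K : R)
  (nu : 'rV[R]_3) : R := relent_rho nu + beta * f_ K nu.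

Definition equilibrium (R : realType) (beta K : R) : set 'rV[R]_3 :=
  [set nu | prob_vec nu /\ forall mu, prob_vec mu ->
     canonical_functional beta K nu <= canonical_functional beta K mu].

Definition partition_fun (R : realType) (beta : R) : R :=
  integ (rho R) (fun y => expR (- beta * y ^+ 2)).

Definition rho_ (R : realType) (beta : R) : 'rV[R]_3 :=
  \row_i ((partition_fun beta)^-1 * expR (- beta * site R i ^+ 2)
          * rho R 0 i).

Definition beta_c (R : realType) : R := ln 4.

Definition K_c2 (R : realType) (beta : R) : R :=
  (4 * beta * expR (- beta))^-1 + (2 * beta)^-1.

(* Main.v *)
(** By the Gibbs inequality, [R(nu|rho) + beta f_K(nu)] is, for every [u], at
    least [const - ln (2 (a + cosh u)) + u m - beta K m^2], where [m] is the mean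
    of [nu] and [a = e^beta / 2], with equality only for the exponential tilt of
    [rho_beta] with parameter [u].  Taking [u = 2 beta K m] linearises the
    quadratic interaction, so the equilibrium macrostates are the tilts at the
    minimisers of the even function
    [u^2 / (4 beta K) - ln (2 (a + cosh u))] of one real variable.  For [w > 0]
    its derivative has the sign of [kappa a w - 2 beta K], with
    [kappa a w = w (a + cosh w) / sinh w].  For [a <= 2], i.e. [beta <= ln 4],
    [kappa a] increases strictly from [1 + a = 2 beta K_c2] to infinity.  Hence
    the minimiser is [0] for [K <= K_c2], and for [K > K_c2] the minimisers are
    [w] and [- w], where [w] is the inverse image of [2 beta K] under [kappa a];
    it is continuous in [K] and tends to [0] as [K] decreases to [K_c2]. *)

Require Import Defs.
From HB Require Import structures.
From mathcomp Require Import all_boot all_order all_algebra.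
From mathcomp Require Import all_classical all_reals all_analysis.
From mathcomp Require Import ring lra.

Import Order.TTheory GRing.Theory Num.Theory.
Import numFieldNormedType.Exports.

Local Open Scope classical_set_scope.
Local Open Scope ring_scope.

(** * Strict monotonicity and hyperbolic functions *)

(** Positivity is asked only on the open interval because it is mostly applied from 0, where the
    derivatives in question vanish. *)
Lemma pos_derive_lt {R : realType} {f df : R -> R} {x y : R} :
  (forall z, x <= z <= y -> is_derive z 1 f (df z)) ->
  (forall z, x < z < y -> 0 < df z) -> x < y -> f x < f y.
Proof.
move=> fd df_gt0 xy.
have [||z] := @MVT _ f df _ _ xy.
- by move=> z; rewrite in_itv/= => /andP[xz zy]; apply: fd; rewrite !ltW.
- apply: derivable_within_continuous => z; rewrite in_itv/= => xzy.
  exact: (@ex_derive _ _ _ _ _ _ _ (fd _ xzy)).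
by rewrite in_itv/= -[f x < _]subr_gt0 => xzy ->; rewrite mulr_gt0 ?df_gt0 ?subr_gt0.
Qed.

Definition cosh {R : realType} (x : R) : R := (expR x + expR (- x)) / 2.

Definition sinh {R : realType} (x : R) : R := (expR x - expR (- x)) / 2.

Global Instance is_derive_cosh {R : realType} (x : R) :
  is_derive x 1 cosh (sinh x).
Proof. by apply: is_derive_eq; rewrite /sinh /GRing.scale/=; field. Qed.

Global Instance is_derive_sinh {R : realType} (x : R) :
  is_derive x 1 sinh (cosh x).
Proof. by apply: is_derive_eq; rewrite /cosh /GRing.scale/=; field. Qed.

Lemma cosh0 {R : realType} : cosh (0 : R) = 1.
Proof. by rewrite /cosh oppr0 expR0; field. Qed.

Lemma sinh0 {R : realType} : sinh (0 : R) = 0.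
Proof. by rewrite /sinh oppr0 subrr mul0r. Qed.

Lemma coshN {R : realType} (x : R) : cosh (- x) = cosh x.
Proof. by rewrite /cosh opprK addrC. Qed.

Lemma cosh_gt0 {R : realType} (x : R) : 0 < cosh x.
Proof. by rewrite divr_gt0// addr_gt0// expR_gt0. Qed.

Lemma sinh_gt0 {R : realType} {x : R} : 0 < x -> 0 < sinh x.
Proof. by move=> x0; rewrite divr_gt0// subr_gt0 ltr_expR; lra. Qed.

Lemma sinh_lt_cosh {R : realType} (x : R) : sinh x < cosh x.
Proof. by rewrite /sinh /cosh; have := expR_gt0 (- x); lra. Qed.

Lemma cosh2D1 {R : realType} (x : R) : cosh x ^+ 2 = sinh x ^+ 2 + 1.
Proof. by rewrite /cosh /sinh expRN; field; rewrite gt_eqF ?expR_gt0. Qed.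

Lemma cosh_gt1 {R : realType} {x : R} : 0 < x -> 1 < cosh x.
Proof.
by move=> /sinh_gt0 s0; have := cosh2D1 x; have := cosh_gt0 x; nra.
Qed.

Lemma continuous_cosh {R : realType} : continuous (@cosh R).
Proof.
by move=> x; apply/differentiable_continuous/derivable1_diffP; apply: ex_derive.
Qed.

Lemma sinh_gtid {R : realType} {x : R} : 0 < x -> x < sinh x.
Proof.
move=> x0.
have := @pos_derive_lt _ (fun y => sinh y - y) (fun y => cosh y - 1) 0 x.
rewrite sinh0 subr0 subr_gt0; apply => //.
by move=> z /andP[z0 _]; rewrite subr_gt0 cosh_gt1.
Qed.

Lemma sinh_lt_mul_cosh {R : realType} {x : R} : 0 < x -> sinh x < x * cosh x.
Proof.
move=> x0.
have := @pos_derive_lt _ (fun y => y * cosh y - sinh y) (fun y => y * sinh y) 0 x.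
rewrite sinh0 mul0r subr0 subr_gt0; apply => //.
- by move=> z _; apply: is_derive_eq; rewrite /GRing.scale/=; ring.
- by move=> z /andP[z0 _]; rewrite mulr_gt0 ?sinh_gt0.
Qed.

(** * Monotonicity and range of [kappa] *)

(* [kappa a w = w / c'(w)] where [c] is the cumulant generating function of
   [rho_beta] and [a = e^beta / 2]; [w > 0] is critical for the reduced
   free energy at [K] iff [kappa a w = 2 beta K]. *)
Definition kappa {R : realType} (a w : R) : R := w * (a + cosh w) / sinh w.

(** After clearing [sinh w], the difference of the two sides and its first derivative both vanish at
    0, so the sign is read off from the second derivative. *)
Lemma kappa_gt {R : realType} {a w : R} :
  a <= 2 -> 0 < w -> 1 + a < kappa a w.
Proof.
move=> a2 w0; rewrite ltr_pdivlMr ?sinh_gt0//.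
have d_gt0 (x : R) : 0 < x -> 0 < a + x * sinh x - a * cosh x.
  move=> x0; have := @pos_derive_lt _ (fun y => a + y * sinh y - a * cosh y)
    (fun y => (1 - a) * sinh y + y * cosh y) 0 x.
  rewrite cosh0 mul0r addr0 mulr1 subrr; apply => //.
  - by move=> z _; apply: is_derive_eq; rewrite /GRing.scale/=; ring.
  (* Since [z cosh z > sinh z], the second derivative exceeds [(2 - a) sinh z >= 0]. *)
  - by move=> z /andP[z0 _]; have := sinh_lt_mul_cosh z0; have := sinh_gt0 z0; nra.
rewrite -subr_gt0.
have := @pos_derive_lt _ (fun y => y * (a + cosh y) - (1 + a) * sinh y)
    (fun y => a + y * sinh y - a * cosh y) 0 w.
rewrite sinh0 !mulr0 mul0r subrr; apply => //.
- by move=> z _; apply: is_derive_eq; rewrite /GRing.scale/=; ring.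
- by move=> z /andP[z0 _]; exact: d_gt0.
Qed.

(* This is where [beta <= beta_c], i.e. [a <= 2], enters. *)
Lemma kappa_derive_num_gt0 {R : realType} {a w : R} : a <= 2 -> 0 < w ->
  0 < sinh w * (a + cosh w) - w * (1 + a * cosh w).
Proof.
move=> a2 w0.
have := @pos_derive_lt _
    (fun y => sinh y * (a + cosh y) - y * (1 + a * cosh y))
    (fun y => sinh y * (2 * sinh y - a * y)) 0 w.
rewrite sinh0 !mul0r subrr; apply => //.
- move=> z _; apply: is_derive_eq; rewrite /GRing.scale/=.
  by have := cosh2D1 z; rewrite !expr2 => e; ring: e.
(* Here [2 sinh z > 2 z >= a z]. *)
- move=> z /andP[z0 _]; rewrite mulr_gt0 ?sinh_gt0//.
  by have := sinh_gtid z0; nra.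
Qed.

Lemma is_derive_kappa {R : realType} (a : R) {w : R} : 0 < w ->
  is_derive w 1 (kappa a)
    ((sinh w * (a + cosh w) - w * (1 + a * cosh w)) / sinh w ^+ 2).
Proof.
move=> w0; have s0 : sinh w != 0 by rewrite gt_eqF// sinh_gt0.
apply: is_derive_eq; rewrite /GRing.scale/=.
by have := cosh2D1 w; rewrite !expr2 => e; field: e.
Qed.

Lemma kappa_lt {R : realType} {a x y : R} :
  a <= 2 -> 0 < x -> x < y -> kappa a x < kappa a y.
Proof.
move=> a2 x0 xy.
apply: (@pos_derive_lt _ (kappa a) _ x y _ _ xy) => z /andP[xz _].
  by apply: is_derive_kappa; lra.
have z0 : 0 < z by lra.
by rewrite divr_gt0 ?exprn_gt0 ?sinh_gt0// kappa_derive_num_gt0.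
Qed.

Lemma kappa_surj {R : realType} {a L : R} : 0 < a -> 1 + a < L ->
  exists2 w, 0 < w & kappa a w = L.
Proof.
move=> a0 aL; have L0 : 0 < L by lra.
(* [L] itself serves as right endpoint: the inequality amounts to [sinh L < a + cosh L]. *)
have L_lt : L < kappa a L.
  rewrite ltr_pdivlMr ?sinh_gt0// ltr_pM2l//.
  by have := sinh_lt_cosh L; lra.
(* Near 0 one has [cosh x < L - a], as [1 < L - a]; with [x < sinh x] this gives
   [kappa a x < a + cosh x < L]. *)
have [x [x0 xL kxL]] : exists x, [/\ 0 < x, x < L & kappa a x < L].
  near (0:R)^'+ => x; exists x.
  have x0 : 0 < x by near: x; exact: nbhs_right_gt.
  have cx : cosh x < L - a.
    near: x; apply: (cvgr_lt (cosh 0)); last by rewrite cosh0; lra.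
    exact: cvg_at_right_filter (@continuous_cosh R 0).
  have xL : x < L by near: x; exact: nbhs_right_lt.
  split => //.
  rewrite ltr_pdivrMr ?sinh_gt0// [ltRHS]mulrC.
  by rewrite ltr_pM ?sinh_gtid ?ltW// ?addr_gt0 ?cosh_gt0//; lra.
have [||w] := @IVT _ (kappa a) x L L (ltW xL).
- apply: derivable_within_continuous => z; rewrite in_itv/= => /andP[xz _].
  exact: (@ex_derive _ _ _ _ _ _ _ (is_derive_kappa a (lt_le_trans x0 xz))).
- by rewrite ge_min le_max (ltW kxL) (ltW L_lt) orbT.
rewrite in_itv/= => /andP[xw _] <-; exists w => //; exact: lt_le_trans xw.
Unshelve. all: by end_near. Qed.

(** * Continuity of the inverse of an increasing function *)

(** Monotonicity turns [f x < k] into [x < g k] and [k < f x] into [g k < x], so bounds on [g] near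
    a point become bounds on [k]. For the limit, [g k < e] as soon as [k < f e], and [c < f e]. *)
Lemma right_inverse_continuous {R : realType} {f g : R -> R} {c : R} :
  (forall x y, 0 < x -> x < y -> f x < f y) -> (forall x, 0 < x -> c < f x) ->
  (forall k, c < k -> 0 < g k /\ f (g k) = k) ->
  {in [set k | c < k], continuous g} /\ g k @[k --> c^'+] --> 0.
Proof.
move=> f_lt f_gt fg.
have g_gt x k : c < k -> 0 < x -> f x < k -> x < g k.
  move=> /fg[g0 fgk] x0; rewrite -{1}fgk; apply: contraTT.
  rewrite -!leNgt le_eqVlt.
  by case/predU1P => [->//|/(f_lt _ _ g0)/ltW].
have g_lt x k : c < k -> 0 < x -> k < f x -> g k < x.
  move=> /fg[g0 fgk] x0; rewrite -{1}fgk; apply: contraTT.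
  rewrite -!leNgt le_eqVlt.
  by case/predU1P => [->//|/(f_lt _ _ x0)/ltW].
split=> [k|]; last first.
  apply/cvgrPdist_lt => e e0; near=> k.
  have ck : c < k by near: k; exact: nbhs_right_gt.
  rewrite sub0r normrN gtr0_norm; last by case: (fg _ ck).
  apply: g_lt => //; near: k; apply: nbhs_right_lt; exact: f_gt.
rewrite inE/= => ck; have [g0 fgk] := fg _ ck.
apply/cvgrPdist_lt => e e0.
(* The bound by [g k / 2] keeps [g k - d] positive, where [f] is known to increase. *)
pose d := Num.min (e / 2) (g k / 2).
have [d0 de dg] : [/\ 0 < d, d < e & d < g k].
  by rewrite lt_min !gt_min !divr_gt0//; split=> //; apply/orP; [left|right]; lra.
near=> l.
have cl : c < l by near: l; exact: lt_nbhsr.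
rewrite distrC ltr_norml; apply/andP; split.
- suff : g k - d < g l by lra.
  apply: g_gt => //; first lra.
  by near: l; apply: lt_nbhsr; rewrite -fgk; apply: f_lt; rewrite fgk; lra.
- suff : g l < g k + d by lra.
  apply: g_lt => //; first lra.
  by near: l; apply: lt_nbhsl; rewrite -{1}fgk; apply: f_lt; lra.
Unshelve. all: by end_near. Qed.

(** * Coordinates on the three-point space *)

Lemma pvecP {R : realType} (nu : 'rV[R]_3) : exists x y z, nu = pvec x y z.
Proof.
exists (nu 0 ord0), (nu 0 (lift ord0 ord0)), (nu 0 (lift ord0 (lift ord0 ord0))).
apply/rowP => -[[|[|[|//]]] i3]; rewrite !mxE/=; congr (nu 0 _); exact: val_inj.
Qed.

Lemma pvec_inj {R : realType} {x y z x' y' z' : R} :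
  pvec x y z = pvec x' y' z' -> [/\ x = x', y = y' & z = z'].
Proof.
move/rowP => e.
have := e ord0; have := e (lift ord0 ord0); have := e (lift ord0 (lift ord0 ord0)).
by rewrite !mxE.
Qed.

Lemma prob_vec_pvec {R : realType} (x y z : R) :
  prob_vec (pvec x y z) <-> [/\ 0 <= x, 0 <= y, 0 <= z & x + y + z = 1].
Proof.
rewrite /prob_vec/= !big_ord_recl big_ord0 !mxE/= addr0 addrA; split.
  move=> [p0 p1]; split=> //.
  - by have := p0 ord0; rewrite mxE.
  - by have := p0 (lift ord0 ord0); rewrite mxE.
  - by have := p0 (lift ord0 (lift ord0 ord0)); rewrite mxE.
by move=> [x0 y0 z0 ->]; split=> // -[[|[|[|//]]] i3]; rewrite mxE.
Qed.

Lemma integ_pvec {R : realType} (x y z : R) (g : R -> R) :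
  integ (pvec x y z) g = g (-1) * x + g 0 * y + g 1 * z.
Proof.
rewrite /integ !big_ord_recl big_ord0 !mxE/= /site /bump/= sub0r subrr.
by rewrite (_ : 2%:R - 1 = 1) ?addr0 ?addrA//; ring.
Qed.

Lemma canonical_functional_pvec {R : realType} (beta K x y z : R) :
  canonical_functional beta K (pvec x y z) =
  x * ln (3 * x) + y * ln (3 * y) + z * ln (3 * z)
    + beta * (x + z - K * (z - x) ^+ 2).
Proof.
rewrite /canonical_functional /f_ !integ_pvec /relent_rho.
by rewrite !big_ord_recl big_ord0 !mxE/=; ring.
Qed.

(** * Gibbs inequality and exponential tilts *)

(** This is [1 + t <= expR t] at [t = ln (q / p)], multiplied by [p]. The terms [p - q] cancel when
    summed over two probability vectors, so equality is tracked entry by entry. *)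
Lemma gibbs_leif {R : realType} {c p q : R} : 0 < c -> 0 <= p -> 0 < q ->
  p * ln (c * q) + (p - q) <= p * ln (c * p) ?= iff (p == q).
Proof.
move=> c0 + q0; rewrite le_eqVlt => /predU1P[<-|p0].
  by apply/leifP; rewrite (lt_eqF q0); lra.
have e : ln (c * q) = ln (c * p) + ln (q / p).
  rewrite -lnM ?posrE ?divr_gt0 ?mulr_gt0//; congr ln; field.
  by rewrite gt_eqF.
have qp : q = p * expR (ln (q / p)).
  by rewrite lnK ?posrE ?divr_gt0//; field; rewrite gt_eqF.
apply/leifP; case: ifPn => [/eqP <-|pq]; first by rewrite subrr addr0.
have : ln (q / p) != 0.
  by apply: contraNneq pq => e0; rewrite qp e0 expR0 mulr1.
move=> /expR_gt1Dx; rewrite -(ltr_pM2l p0) -qp e; lra.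
Qed.

(* The law with density proportional to [expR (u * y)] with respect to
   [rho_ beta], for [a = expR beta / 2]. *)
Definition tilt {R : realType} (a u : R) : 'rV[R]_3 :=
  pvec (expR (- u) / (2 * (a + cosh u))) (a / (a + cosh u))
       (expR u / (2 * (a + cosh u))).

Lemma tilt_den_gt0 {R : realType} {a : R} (u : R) : 0 < a -> 0 < a + cosh u.
Proof. by move=> a0; rewrite addr_gt0 ?cosh_gt0. Qed.

Lemma prob_tilt {R : realType} {a : R} (u : R) : 0 < a -> prob_vec (tilt a u).
Proof.
move=> a0; have d0 := tilt_den_gt0 u a0; apply/prob_vec_pvec; split.
- by rewrite divr_ge0 ?expR_ge0 ?mulr_ge0 ?ltW.
- by rewrite divr_ge0 ?ltW.
- by rewrite divr_ge0 ?expR_ge0 ?mulr_ge0 ?ltW.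
- by move: d0; rewrite /cosh => d0; field; apply/eqP; lra.
Qed.

Lemma partition_funE {R : realType} (beta : R) :
  partition_fun beta = (1 + 2 * expR (- beta)) / 3.
Proof.
rewrite /partition_fun integ_pvec sqrrN expr1n expr0n/= mulr0 mulr1 expR0.
by field.
Qed.

Lemma rho_E {R : realType} (beta : R) : rho_ beta = tilt (expR beta / 2) 0.
Proof.
have p0 := expR_gt0 beta.
have s0 : site R ord0 = -1 by rewrite /site sub0r.
have s1 : site R (lift ord0 ord0) = 0 by rewrite /site subrr.
have s2 : site R (lift ord0 (lift ord0 ord0)) = 1.
  by rewrite /site /= /bump/=; ring.
have [x [y [z e]]] := pvecP (rho_ beta); move: (e) => /rowP e'.
have := e' ord0; have := e' (lift ord0 ord0).
have := e' (lift ord0 (lift ord0 ord0)).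
rewrite !mxE/= s0 s1 s2 sqrrN expr1n expr0n/= mulr0 mulr1 expR0 partition_funE.
rewrite expRN e => <- <- <-.
rewrite /tilt oppr0 cosh0 expR0.
by congr (pvec _ _ _); field; apply/andP; split; rewrite gt_eqF//; lra.
Qed.

(** The middle weight determines the denominator, hence only [cosh u]; the last weight then gives
    [expR u] and with it the sign. *)
Lemma tilt_inj {R : realType} {a : R} : 0 < a -> injective (tilt a).
Proof.
move=> a0 u v /pvec_inj[_ e1 e2].
have [du dv] := (tilt_den_gt0 u a0, tilt_den_gt0 v a0).
have /invr_inj d_eq : (a + cosh u)^-1 = (a + cosh v)^-1.
  by move: e1 => /mulfI; apply; rewrite gt_eqF.
move: e2; rewrite d_eq => /mulIf e2; apply/expR_inj/e2.
by rewrite invr_eq0 gt_eqF// mulr_gt0.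
Qed.

Lemma tiltN {R : realType} {a u x y z : R} :
  tilt a u = pvec x y z -> tilt a (- u) = pvec z y x.
Proof. by rewrite /tilt coshN opprK => /pvec_inj[-> -> ->]. Qed.

Lemma continuous_tilt {R : realType} {a : R} : 0 < a -> continuous (tilt a).
Proof.
move=> a0 u.
have d0 := tilt_den_gt0 u a0.
have cd : (fun v => a + cosh v) @ u --> a + cosh u.
  by apply: cvgD; [exact: cvg_cst|exact: continuous_cosh].
have cd2 : (fun v => 2 * (a + cosh v)) @ u --> 2 * (a + cosh u).
  by apply: cvgM => //; exact: cvg_cst.
have n0 : a + cosh u != 0 by rewrite gt_eqF.
have n2 : 2 * (a + cosh u) != 0 by rewrite gt_eqF// mulr_gt0.
have c0 : (fun v => expR (- v) / (2 * (a + cosh v))) @ u -->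
    expR (- u) / (2 * (a + cosh u)).
  apply: cvgM; last exact: cvgV.
  by apply: continuous_comp; [exact: oppr_continuous|exact: continuous_expR].
have c1 : (fun v => a / (a + cosh v)) @ u --> a / (a + cosh u).
  by apply: cvgM; [exact: cvg_cst|exact: cvgV].
have c2 : (fun v => expR v / (2 * (a + cosh v))) @ u -->
    expR u / (2 * (a + cosh u)).
  by apply: cvgM; [exact: continuous_expR|exact: cvgV].
apply/cvg_ballP => e e0.
near=> v.
split=> // i [[|[|[|//]]] j3]; rewrite !mxE/=; near: v;
  [exact: (cvg_ball c0)|exact: (cvg_ball c1)|exact: (cvg_ball c2)].
Unshelve. all: by end_near. Qed.

(** The log-density of [tilt a u] is affine in the site up to an extra [beta] at site 0. That extra
    term combines with the energy [beta (x + z)] into the constant [beta], so the bound sees [nu]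
    only through its mean. *)
Lemma canonical_functional_leif {R : realType} (beta K u : R) nu :
  let a := expR beta / 2 in let m := integ nu id in prob_vec nu ->
  ln 3 + beta - ln (2 * (a + cosh u)) + u * m - beta * K * m ^+ 2
    <= canonical_functional beta K nu ?= iff (nu == tilt a u).
Proof.
have [x [y [z ->]]] := pvecP nu => a m /prob_vec_pvec[x0 y0 z0 xyz].
have a0 : 0 < a by rewrite divr_gt0 ?expR_gt0.
have d0 := tilt_den_gt0 u a0.
have d2 : 0 < 2 * (a + cosh u) by rewrite mulr_gt0.
set px := expR (- u) / (2 * (a + cosh u)); set py := a / (a + cosh u).
set pz := expR u / (2 * (a + cosh u)).
have px0 : 0 < px by rewrite divr_gt0 ?expR_gt0.
have py0 : 0 < py by rewrite divr_gt0.
have pz0 : 0 < pz by rewrite divr_gt0 ?expR_gt0.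
have /prob_vec_pvec[_ _ _ p1] := prob_tilt u a0; rewrite -/px -/py -/pz in p1.
have ln_div3 (t d : R) : 0 < d -> ln (3 * (expR t / d)) = ln 3 + t - ln d.
  move=> d_gt0; rewrite lnM ?posrE ?divr_gt0 ?expR_gt0//.
  by rewrite ln_div ?posrE ?expR_gt0// expRK addrA.
(* As [2 a = expR beta], all three weights are exponentials over the same denominator. *)
have ln_py : ln (3 * py) = ln 3 + beta - ln (2 * (a + cosh u)).
  have aE : expR beta = 2 * a by rewrite /a; field.
  rewrite -ln_div3// /py aE; congr (ln (3 * _)); clearbody a.
  by field; rewrite gt_eqF.
have c3 : 0 < 3 :> R by [].
have := leifD (leifD (gibbs_leif c3 x0 px0) (gibbs_leif c3 y0 py0))
  (gibbs_leif c3 z0 pz0).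
rewrite ln_py !ln_div3// => h.
have -> : (pvec x y z == tilt a u) = [&& x == px, y == py & z == pz].
  apply/eqP/and3P => [/pvec_inj[-> -> ->]//|[/eqP -> /eqP -> /eqP ->]//].
rewrite canonical_functional_pvec /m integ_pvec.
rewrite -andbA -(mono_leif (lerD2r (beta * (x + z - K * (z - x) ^+ 2)))) in h *.
congr (_ <= _ ?= iff _): h.
have -> : y = 1 - x - z by lra.
have -> : py = 1 - px - pz by lra.
by ring.
Qed.

(** * Reduction to one real variable *)

Definition reduced {R : realType} (a L u : R) : R :=
  u ^+ 2 / (2 * L) - ln (2 * (a + cosh u)).

(* The Gibbs inequality at [u = 2 beta K m], with [m] the mean of [nu], bounds
   the functional at [nu] below by [reduced] at [u]; completing the square
   bounds the functional at [tilt a u] above by [reduced] at [u]. *)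
Lemma equilibriumE {R : realType} {beta K : R} : 0 < beta -> 0 < K ->
  let a := expR beta / 2 in let L := 2 * beta * K in
  equilibrium beta K =
  tilt a @` [set w | forall u, reduced a L w <= reduced a L u].
Proof.
move=> b0 K0 a L.
have a0 : 0 < a by rewrite divr_gt0 ?expR_gt0.
have L0 : 0 < L by rewrite !mulr_gt0.
have upper u : canonical_functional beta K (tilt a u)
    <= ln 3 + beta + reduced a L u.
  (* Equality holds at the tilt, and the gap to be shown nonnegative is [(u - L m)^2 / (2 L)]. *)
  have [_] := canonical_functional_leif beta K u _ (prob_tilt u a0).
  rewrite eqxx => /eqP <-; set m := integ _ _.
  rewrite -/a /reduced -subr_ge0.
  have : 0 <= (u - L * m) ^+ 2 / (2 * L).
    by rewrite divr_ge0 ?sqr_ge0// mulr_ge0// ltW.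
  congr (0 <= _); rewrite /L; field.
  by rewrite !gt_eqF.
have lower nu : prob_vec nu -> let u := L * integ nu id in
    ln 3 + beta + reduced a L u <= canonical_functional beta K nu
      ?= iff (nu == tilt a u).
  move=> pnu u; have := canonical_functional_leif beta K u _ pnu.
  congr (_ <= _ ?= iff _); rewrite /reduced /u /L -/a.
  by field; rewrite !gt_eqF.
apply/seteqP; split=> [nu [pnu nu_min]|_ [w w_min <-]].
  have [le_nu eq_nu] := lower nu pnu; set u := L * _ in le_nu eq_nu.
  (* A minimiser is squeezed: [lower] and [upper] show that [u] minimises [reduced], and [upper] at
     [u] forces equality in [lower], hence [nu = tilt a u]. *)
  have le_red w : canonical_functional beta K nu <= ln 3 + beta + reduced a L w.
    by apply: le_trans (upper w); exact/nu_min/prob_tilt.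
  exists u => [w|]; first by have := le_trans le_nu (le_red w); rewrite lerD2l.
  by apply/esym/eqP; rewrite -eq_nu eq_le le_nu le_red.
split=> [|mu pmu]; first exact: prob_tilt.
apply: le_trans (upper w) _; apply: le_trans (lower mu pmu).
by rewrite lerD2l.
Qed.

Lemma reducedN {R : realType} (a L u : R) : reduced a L (- u) = reduced a L u.
Proof. by rewrite /reduced sqrrN coshN. Qed.

Lemma is_derive_reduced {R : realType} {a : R} (L u : R) : 0 < a ->
  is_derive u 1 (reduced a L) (u / L - sinh u / (a + cosh u)).
Proof.
move=> a0; have d0 := tilt_den_gt0 u a0.
have d1 : is_derive u 1 (fun v => 2 * (a + cosh v)) (2 * sinh u).
  by apply: is_derive_eq; rewrite /GRing.scale/=; ring.
have d2 := @is_derive1_comp _ (@ln R) _ u _ _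
  (is_derive1_ln (mulr_gt0 (ltr0n _ 2) d0)) d1.
have d3 : is_derive u 1 (fun v : R => v ^+ 2 / (2 * L)) (u / L).
  by apply: is_derive_eq; rewrite /GRing.scale/= invfM; move: L^-1 => l; field.
apply: (is_derive_eq (is_deriveB d3 d2)).
by congr (_ - _); field; rewrite gt_eqF.
Qed.

(** The hypotheses compare [kappa] with [L] on either side of [w] instead of asking [kappa a w = L],
    so that [w = 0] covers the subcritical range too. Evenness of [reduced] extends the comparison
    from [u >= 0] to all [u]. *)
Lemma reduced_min {R : realType} {a L w : R} : 0 < a -> 0 < L -> 0 <= w ->
  (forall z, w < z -> L < kappa a z) ->
  (forall z, 0 < z < w -> kappa a z < L) ->
  [set v | forall u, reduced a L v <= reduced a L u] = [set w; - w].
Proof.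
move=> a0 L0 w0 kgt klt.
have lt_pos u : 0 <= u -> u != w -> reduced a L w < reduced a L u.
  move=> u0; rewrite neq_lt => /orP[uw|wu].
    rewrite -ltrN2; apply: (@pos_derive_lt _ (fun v => - reduced a L v)
      (fun v => - (v / L - sinh v / (a + cosh v))) u w) => // z.
      by move=> _; have d := is_derive_reduced L z a0; exact: is_deriveN.
    move=> /andP[uz zw]; have z0 : 0 < z by lra.
    have := klt z; rewrite z0 zw => /(_ isT); rewrite /kappa.
    rewrite ltr_pdivrMr ?sinh_gt0// => h.
    rewrite oppr_gt0 subr_lt0 ltr_pdivrMr// mulrAC ltr_pdivlMr ?tilt_den_gt0//.
    by rewrite [ltRHS]mulrC.
  apply: (@pos_derive_lt _ (reduced a L)
    (fun v => v / L - sinh v / (a + cosh v)) w u) => // z.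
    by move=> _; exact: is_derive_reduced.
  move=> /andP[wz zu]; have z0 : 0 < z by lra.
  have := kgt z wz; rewrite /kappa ltr_pdivlMr ?sinh_gt0// => h.
  rewrite subr_gt0 ltr_pdivlMr// mulrAC ltr_pdivrMr ?tilt_den_gt0//.
  by rewrite mulrC.
have abs_lt u : `|u| != w -> reduced a L w < reduced a L u.
  move=> uw; have := lt_pos _ (normr_ge0 u) uw.
  by case: (ger0P u); rewrite ?reducedN.
apply/seteqP; split=> v /=.
  move=> v_min; have [|/abs_lt] := eqVneq `|v| w; last first.
    by rewrite ltNge v_min.
  by case: (ger0P v) => _ <-; [left|right; rewrite opprK].
move=> vw u; have -> : reduced a L v = reduced a L w.
  by case: vw => ->; rewrite ?reducedN.
have [<-|/abs_lt/ltW//] := eqVneq `|u| w.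
by case: (ger0P u); rewrite ?reducedN.
Qed.

(** * Critical value and the bifurcating branches *)

Lemma K_c2E {R : realType} (beta : R) : beta != 0 ->
  K_c2 beta = (1 + expR beta / 2) / (2 * beta).
Proof.
by move=> b0; rewrite /K_c2 expRN; field; rewrite b0 gt_eqF ?expR_gt0.
Qed.

(** Dividing [kappa] by [2 beta] makes [W] a right inverse in the variable [K] itself, in which
    continuity is wanted. *)
Lemma kappa_inverse {R : realType} {a beta : R} : 0 < a -> 0 < beta ->
  exists W : R -> R, forall K, (1 + a) / (2 * beta) < K ->
    0 < W K /\ kappa a (W K) / (2 * beta) = K.
Proof.
move=> a0 b0; have b2 : 0 < 2 * beta by rewrite mulr_gt0.
have [K|W WP] := @boolp.choice _ _ (fun K w => (1 + a) / (2 * beta) < K ->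
  0 < w /\ kappa a w / (2 * beta) = K); last by exists W.
(* Up to the threshold the requirement is vacuous, and 0 is a default witness. *)
have [|_] := ltP _ K; last by exists 0.
rewrite ltr_pdivrMr// => /(kappa_surj a0)[w w0 kw]; exists w => _; split=> //.
by rewrite kw mulfK ?gt_eqF.
Qed.

Theorem theorem3p1 (R : realType) (beta : R)
    (hbeta0 : 0 < beta) (hbetac : beta <= beta_c R) :
  0 < K_c2 beta /\
  (forall K : R, 0 < K -> K <= K_c2 beta ->
     equilibrium beta K = [set rho_ beta]) /\
  exists nu_plus nu_minus : R -> 'rV[R]_3,
    (forall K : R, K_c2 beta < K ->
       prob_vec (nu_plus K) /\ prob_vec (nu_minus K) /\
       nu_plus K <> nu_minus K /\
       nu_plus K <> rho_ beta /\
       nu_minus K <> rho_ beta /\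
       equilibrium beta K = [set nu_plus K; nu_minus K]) /\
    (forall K : R, K_c2 beta < K ->
       forall a b c : R,
         nu_plus K = pvec a b c -> nu_minus K = pvec c b a) /\
    ({within [set K : R | K_c2 beta < K], continuous nu_plus} /\
     nu_plus K @[K --> (K_c2 beta)^'+] --> rho_ beta) /\
    ({within [set K : R | K_c2 beta < K], continuous nu_minus} /\
     nu_minus K @[K --> (K_c2 beta)^'+] --> rho_ beta).
Proof.
set a := expR beta / 2.
have a0 : 0 < a by rewrite divr_gt0 ?expR_gt0.
have a2 : a <= 2.
  rewrite /a ler_pdivrMr// (_ : 2 * 2 = expR (ln 4)) ?ler_expR//.
  by rewrite lnK ?posrE//; ring.
have b2 : 0 < 2 * beta by rewrite mulr_gt0.
have KcE : K_c2 beta = (1 + a) / (2 * beta) by rewrite K_c2E ?gt_eqF.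
have Kc0 : 0 < K_c2 beta by rewrite KcE divr_gt0 ?addr_gt0.
split=> //; split=> [K K0 KKc|].
  (* With [w = 0] the two minimisers [w] and [- w] coincide, and the condition on [0 < z < w] is
     empty. *)
  rewrite equilibriumE// -/a (@reduced_min _ a _ 0)// ?mulr_gt0//.
  - by rewrite oppr0 setUid image_set1 rho_E.
  - move=> z z0; apply: le_lt_trans (kappa_gt a2 z0).
    by move: KKc; rewrite KcE ler_pdivlMr// mulrC.
  - by move=> z /andP[z0 /(lt_trans z0)]; rewrite ltxx.
have [W WP] := kappa_inverse a0 hbeta0; rewrite -KcE in WP.
have [W_cont W_cvg] :
    {in [set K | K_c2 beta < K], continuous W} /\ W K @[K --> (K_c2 beta)^'+] --> 0.
  apply: (@right_inverse_continuous _ (fun w => kappa a w / (2 * beta))) => //.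
  - by move=> x y x0 xy; rewrite ltr_pM2r ?invr_gt0// kappa_lt.
  - by move=> x x0; rewrite KcE ltr_pM2r ?invr_gt0// kappa_gt.
exists (fun K => tilt a (W K)), (fun K => tilt a (- W K)).
have WN_cvg : - W K @[K --> (K_c2 beta)^'+] --> 0.
  by rewrite -oppr0; exact: cvgN.
have open_Kc : open [set K | K_c2 beta < K] by exact: open_gt.
split=> [K KcK|]; last split=> [K _ x y z|]; [|exact: tiltN|].
  have [W0 kW] := WP K KcK; have K0 := lt_trans Kc0 KcK.
  have kWE : kappa a (W K) = 2 * beta * K by rewrite -[in RHS]kW mulrC mulfVK ?gt_eqF.
  do 2 (split; first exact: prob_tilt).
  (* The parameters [W K], [- W K] and 0 are distinct since [W K > 0], so the three tilts are
     distinct. *)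
  split; first by move/(tilt_inj a0); lra.
  rewrite rho_E; do 2 (split; first by move/(tilt_inj a0); lra).
  rewrite equilibriumE// -/a (@reduced_min _ a _ (W K))// ?mulr_gt0 ?ltW//.
  - by rewrite image_setU !image_set1.
  - by move=> z; rewrite -kWE; exact: kappa_lt.
  - by move=> z /andP[z0 zW]; rewrite -kWE; exact: kappa_lt.
split; split.
- rewrite continuous_open_subspace// => K /W_cont WK.
  by apply: continuous_comp; [exact: WK|exact: continuous_tilt].
- rewrite rho_E; apply: continuous_cvg W_cvg; exact: continuous_tilt.
- rewrite continuous_open_subspace// => K /W_cont WK.
  apply: (@continuous_comp _ _ _ (fun K => - W K)); last exact: continuous_tilt.
  by apply: continuousN; exact: WK.
- rewrite rho_E; apply: continuous_cvg WN_cvg; exact: continuous_tilt.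
Qed.
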